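(* Let $T\in\mathcal{BC}^{0,1}(V_5)$. Then for $p,s\in\rho_{\mathcal F}(T)$ with $s\notin[p]$ the following equation holds: $$\begin{aligned} &\mathcal F_5^R(s,T)S_L^{-1}(p,T)+S_R^{-1}(s,T)\mathcal F_5^L(p,T)+\gamma_5\,\mathcal Q_s(T)S_R^{-1}(s,T)S_L^{-1}(p,T)\mathcal Q_p(T)\\ &\quad+\gamma_5\big[\mathcal Q_s^2(T)\mathcal Q_p(T)+\mathcal Q_s(T)\mathcal Q_p^2(T)\big]\\ &=\big\{[\mathcal F_5^R(s,T)-\mathcal F_5^L(p,T)]p-\overline s[\mathcal F_5^R(s,T)-\mathcal F_5^L(p,T)]\big\}(p^2-2s_0p+|s|^2)^{-1}. \end{aligned}$$
   Context: Take $n=5$. $\mathbb R_n$ is the real Clifford algebra generated by $e_1,\dots,e_n$ with $e_\ell^2=-1$ and $e_\ell e_m+e_me_\ell=0$ for $\ell\neq m$. A point of $\mathbb R^{n+1}$ is identified with the paravector $x=x_0+\underline x$, $\underline x=\sum_{j=1}^n x_je_j$; $\overline x=x_0-\underline x$, $|x|^2=\sum_{j=0}^nx_j^2$. $\mathbb S$ is the set of $\underline x$ with $|\underline x|=1$ and $[x]=\{x_0+J|\underline x|:J\in\mathbb S\}$. $V$ is a real Banach space, $V_n=V\otimes\mathbb R_n$ is the associated two-sided Banach module over $\mathbb R_n$, and $\mathcal B(V_n)$ is the space of bounded right linear operators on $V_n$. Clifford numbers act on operators by $(aT)(v)=a\,T(v)$, $(Ta)(v)=T(av)$; products of operators are compositions.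 $\mathcal{BC}^{0,1}(V_n)$ is the set of paravector operators $T=T_0+\sum_{\ell=1}^n e_\ell T_\ell$ with pairwise commuting components $T_\ell\in\mathcal B(V)$ (acting componentwise on $V_n$). Put $\overline T=T_0-\sum_{\ell=1}^n e_\ell T_\ell$, so that $T+\overline T=2T_0$ and $T\overline T=\sum_{\ell=0}^nT_\ell^2$. $\rho_{\mathcal F}(T)$ is the set of $s\in\mathbb R^{n+1}$ such that $s^2\mathcal I-s(T+\overline T)+T\overline T$ is invertible in $\mathcal B(V_n)$. For $s\in\rho_{\mathcal F}(T)$: $\mathcal Q_s(T)=(s^2\mathcal I-s(T+\overline T)+T\overline T)^{-1}$, $\mathcal Q_s^k(T)=(\mathcal Q_s(T))^k$, $S_L^{-1}(s,T)=(s\mathcal I-\overline T)\mathcal Q_s(T)$, $S_R^{-1}(s,T)=\mathcal Q_s(T)(s\mathcal I-\overline T)$, $\mathcal F_5^L(s,T)=\gamma_5(s\mathcal I-\overline T)\mathcal Q_s(T)^{3}$, $\mathcal F_5^R(s,T)=\gamma_5\mathcal Q_s(T)^{3}(s\mathcal I-\overline T)$, where $\gamma_5=2^4(2!)^2=64$. *)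

(* Defs.v *)
From HB Require Import structures.
From mathcomp Require Import all_boot all_order all_algebra all_field.
From mathcomp Require Import all_classical all_reals all_analysis.
Import Order.TTheory GRing.Theory Num.Theory numFieldNormedType.Exports.

Set Implicit Arguments.
Unset Strict Implicit.
Unset Printing Implicit Defensive.

Local Open Scope ring_scope.

#[local] Obligation Tactic := idtac.

(* The real Clifford algebra R_n: an element is the family of its coordinates
   in the basis e_A = e_(a1) ... e_(ak), A = {a1 < ... < ak}.  The generators
   e_1, ..., e_n are indexed by 'I_n, i.e. from 0. *)
Definition clifford (R : realType) (n : nat) : Type := {ffun {set 'I_n} -> R}.

Section Clifford.
Variables (R : realType) (n : nat).
Implicit Types (A B C : {set 'I_n}) (a b c : clifford R n).

HB.instance Definition _ := Vector.copy (clifford R n) {ffun {set 'I_n} -> R^o}.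

Definition cbasis A : clifford R n := [ffun B => (A == B)%:R].

Definition symdiff A B := (A :\: B) :|: (B :\: A).

(* Reordering e_A e_B into e_(A symdiff B) costs one sign for every pair
   i in A, j in B with j < i (anticommutation) and one for every j = i
   (e_i ^ 2 = -1). *)
Definition csign A B : R := (-1) ^+ (\sum_(i in A) \sum_(j in B) (j <= i)%N)%N.

Definition cmul a b : clifford R n :=
  \sum_A \sum_B (a A * b B * csign A B) *: cbasis (symdiff A B).

Lemma cbasisE a : a = \sum_A a A *: cbasis A.
Proof.
apply/ffunP => B; rewrite sum_ffunE (bigD1 B) //= big1 ?addr0.
  by rewrite !ffunE eqxx /GRing.scale /= mulr1.
by move=> A /negPf AB; rewrite !ffunE AB /GRing.scale /= mulr0.
Qed.

Lemma in_symdiff A B i : (i \in symdiff A B) = (i \in A) (+) (i \in B).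
Proof. by rewrite !inE; case: (i \in A); case: (i \in B). Qed.

Lemma symdiffA A B C : symdiff A (symdiff B C) = symdiff (symdiff A B) C.
Proof. by apply/setP => i; rewrite !in_symdiff addbA. Qed.

Lemma symdiff0s A : symdiff finset.set0 A = A.
Proof. by apply/setP => i; rewrite in_symdiff inE. Qed.

Lemma symdiffs0 A : symdiff A finset.set0 = A.
Proof. by apply/setP => i; rewrite in_symdiff inE addbF. Qed.

Lemma odd_sum_symdiff A B (f : 'I_n -> nat) :
  odd (\sum_(i in symdiff A B) f i) = odd (\sum_(i in A) f i + \sum_(i in B) f i).
Proof.
rewrite (big_mkcond (mem (symdiff A B))) (big_mkcond (mem A)).
rewrite (big_mkcond (mem B)) -big_split /=.
apply: (big_rec2 (fun u v => odd u = odd v)) => // i v u _ IH.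
rewrite !oddD {}IH in_symdiff.
by case: (i \in A); case: (i \in B); rewrite //= ?addbb ?addbF.
Qed.

Lemma csign_symdiffl A B C : csign (symdiff A B) C = csign A C * csign B C.
Proof. by rewrite /csign -signr_odd odd_sum_symdiff signr_odd exprD. Qed.

Lemma csign_symdiffr A B C : csign A (symdiff B C) = csign A B * csign A C.
Proof.
have csignE D : csign A D = (-1) ^+ (\sum_(j in D) \sum_(i in A) (j <= i)%N)%N.
  by rewrite /csign exchange_big.
by rewrite !csignE -signr_odd odd_sum_symdiff signr_odd exprD.
Qed.

Lemma csign0s A : csign finset.set0 A = 1.
Proof. by rewrite /csign big_set0. Qed.

Lemma csigns0 A : csign A finset.set0 = 1.
Proof. by rewrite /csign big1 // => i _; rewrite big_set0. Qed.

Lemma cmulDl a b c : cmul (a + b) c = cmul a c + cmul b c.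
Proof.
rewrite /cmul -big_split; apply: eq_bigr => A _; rewrite -big_split.
by apply: eq_bigr => B _; rewrite ffunE !mulrDl scalerDl.
Qed.

Lemma cmulDr a b c : cmul a (b + c) = cmul a b + cmul a c.
Proof.
rewrite /cmul -big_split; apply: eq_bigr => A _; rewrite -big_split.
by apply: eq_bigr => B _; rewrite ffunE mulrDr mulrDl scalerDl.
Qed.

Lemma cmulZl k a b : cmul (k *: a) b = k *: cmul a b.
Proof.
rewrite /cmul scaler_sumr; apply: eq_bigr => A _; rewrite scaler_sumr.
by apply: eq_bigr => B _; rewrite ffunE scalerA !mulrA.
Qed.

Lemma cmulZr k a b : cmul a (k *: b) = k *: cmul a b.
Proof.
rewrite /cmul scaler_sumr; apply: eq_bigr => A _; rewrite scaler_sumr.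
by apply: eq_bigr => B _; rewrite ffunE scalerA !mulrA [a A * k]mulrC.
Qed.

Lemma cmul_suml I (s : seq I) (f : I -> clifford R n) b :
  cmul (\sum_(i <- s) f i) b = \sum_(i <- s) cmul (f i) b.
Proof.
apply: (big_morph (cmul^~ b)) => [x y|]; first exact: cmulDl.
by rewrite -[in LHS](scale0r b) cmulZl scale0r.
Qed.

Lemma cmul_sumr I (s : seq I) (f : I -> clifford R n) a :
  cmul a (\sum_(i <- s) f i) = \sum_(i <- s) cmul a (f i).
Proof.
apply: (big_morph (cmul a)) => [x y|]; first exact: cmulDr.
by rewrite -[in LHS](scale0r a) cmulZr scale0r.
Qed.

Lemma cmul_basis A B :
  cmul (cbasis A) (cbasis B) = csign A B *: cbasis (symdiff A B).
Proof.
rewrite /cmul (bigD1 A) //= [X in _ + X]big1 => [|C /negPf CA]; last first.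
  by rewrite big1 // => D _; rewrite ffunE eq_sym CA !mul0r scale0r.
rewrite addr0 (bigD1 B) //= [X in _ + X]big1 => [|C /negPf CB]; last first.
  by rewrite !ffunE [B == C]eq_sym CB mulr0 mul0r scale0r.
by rewrite addr0 !ffunE !eqxx !mul1r.
Qed.

Lemma cmulA : associative cmul.
Proof.
move=> a b c.
rewrite {1}(cbasisE a) cmul_suml [in RHS](cbasisE a).
rewrite [X in _ = cmul X c]cmul_suml [RHS]cmul_suml; apply: eq_bigr => A _.
rewrite [LHS]cmulZl [X in _ = cmul X c]cmulZl [RHS]cmulZl; congr (_ *: _).
rewrite [in LHS](cbasisE b) [in RHS](cbasisE b).
rewrite [X in cmul _ X = _]cmul_suml [LHS]cmul_sumr.
rewrite [X in _ = cmul X c]cmul_sumr [RHS]cmul_suml; apply: eq_bigr => B _.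
rewrite [X in cmul _ X = _]cmulZl [LHS]cmulZr [X in _ = cmul X c]cmulZr [RHS]cmulZl.
congr (_ *: _); rewrite [in LHS](cbasisE c) [in RHS](cbasisE c).
rewrite [X in cmul _ X = _]cmul_sumr [LHS]cmul_sumr [RHS]cmul_sumr.
apply: eq_bigr => C _.
rewrite [X in cmul _ X = _]cmulZr [LHS]cmulZr [RHS]cmulZr; congr (_ *: _).
rewrite (cmul_basis B) (cmul_basis A) [LHS]cmulZr [RHS]cmulZl !cmul_basis.
rewrite !scalerA symdiffA csign_symdiffl csign_symdiffr; congr (_ *: _).
by rewrite mulrC -mulrA.
Qed.

Lemma cmul1c : left_id (cbasis finset.set0) cmul.
Proof.
move=> a; rewrite {1}(cbasisE a) cmul_sumr [RHS]cbasisE; apply: eq_bigr => A _.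
by rewrite cmulZr cmul_basis csign0s symdiff0s scale1r.
Qed.

Lemma cmulc1 : right_id (cbasis finset.set0) cmul.
Proof.
move=> a; rewrite {1}(cbasisE a) cmul_suml [RHS]cbasisE; apply: eq_bigr => A _.
by rewrite cmulZl cmul_basis csigns0 symdiffs0 scale1r.
Qed.

Lemma cbasis0_neq0 : cbasis finset.set0 != 0.
Proof.
by apply/eqP => /ffunP/(_ finset.set0)/eqP; rewrite !ffunE eqxx oner_eq0.
Qed.

HB.instance Definition _ := GRing.Zmodule_isNzRing.Build (clifford R n)
  cmulA cmul1c cmulc1 cmulDl cmulDr cbasis0_neq0.

Lemma cscaleAl (k : R) a b : k *: (a * b) = k *: a * b.
Proof. by rewrite -[RHS]/(cmul _ _) cmulZl. Qed.

HB.instance Definition _ :=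
  GRing.Lmodule_isLalgebra.Build R (clifford R n) cscaleAl.

Lemma cscaleAr (k : R) a b : k *: (a * b) = a * (k *: b).
Proof. by rewrite -[RHS]/(cmul _ _) cmulZr. Qed.

HB.instance Definition _ :=
  GRing.Lalgebra_isAlgebra.Build R (clifford R n) cscaleAr.

(* x^-1 is the two-sided inverse of x in R_n if x has one, and x otherwise. *)
HB.instance Definition _ := Algebra_isFalgebra.Build R (clifford R n).

Definition cgen (l : 'I_n) : clifford R n := cbasis [set l].

Lemma gen_sqr l : cgen l ^+ 2 = -1.
Proof.
rewrite expr2 -[LHS]/(cmul _ _) cmul_basis /csign !big_set1 leqnn expr1.
rewrite scaleN1r; congr (- cbasis _).
by apply/setP => i; rewrite in_symdiff addbb inE.
Qed.

Lemma gen_anticomm l m : l != m -> cgen l * cgen m + cgen m * cgen l = 0.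
Proof.
move=> lm; rewrite -[X in X + _]/(cmul _ _) -[X in _ + X]/(cmul _ _).
rewrite !cmul_basis /csign !big_set1.
have -> : symdiff [set m] [set l] = symdiff [set l] [set m].
  by apply/setP => i; rewrite !in_symdiff addbC.
rewrite -scalerDl; case: (ltngtP l m) => [||/val_inj/eqP] //=; last first.
- by rewrite (negPf lm).
- by rewrite expr0 expr1 addNr scale0r.
- by rewrite expr0 expr1 addrN scale0r.
Qed.

End Clifford.

Local Open Scope classical_set_scope.

(* Points of R^(n+1), coordinate 0 being the scalar one. *)
Notation paravector R n := 'rV[R]_n.+1.

Section Paravector.
Variables (R : realType) (n : nat).
Implicit Types x : paravector R n.

Definition pre x : R := x 0 ord0.

(* The vector part of x, seen in R^(n+1) with scalar coordinate 0. *)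
Definition pvec x : paravector R n := x - pre x *: delta_mx 0 ord0.

Definition pconj x : paravector R n := pre x *: delta_mx 0 ord0 - pvec x.

Definition pabs x : R := Num.sqrt (\sum_j x 0 j ^+ 2).

Definition pcliff x : clifford R n :=
  (pre x)%:A + \sum_(j < n) x 0 (lift ord0 j) *: cgen R j.

Definition unit_imaginary : set (paravector R n) :=
  [set J | pre J = 0 /\ pabs J = 1].

Definition psphere x : set (paravector R n) :=
  [set pre x *: delta_mx 0 ord0 + pabs (pvec x) *: J | J in unit_imaginary].

End Paravector.

Definition bounded_map (R : realType) (X Y : normedModType R) (f : X -> Y) :=
  exists M : R, forall x, `|f x| <= M * `|x|.

(* V_n = V (x) R_n: v stands for \sum_A v_A (x) e_A. *)
Definition cmodule (R : realType) (V : normedModType R) (n : nat) : Type :=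
  {ffun {set 'I_n} -> V}.

Section CliffordModule.
Variables (R : realType) (V : normedModType R) (n : nat).
Implicit Types (u v w : cmodule V n) (a b c : clifford R n) (x y : V).

HB.instance Definition _ :=
  GRing.Lmodule.copy (cmodule V n) {ffun {set 'I_n} -> V}.

Definition cmodule_norm v : R := \sum_A `|v A|.

Lemma cmodule_normD v w :
  cmodule_norm (v + w) <= cmodule_norm v + cmodule_norm w.
Proof.
rewrite /cmodule_norm -big_split; apply: ler_sum => A _.
by rewrite ffunE ler_normD.
Qed.

Lemma cmodule_normZ (k : R) v : cmodule_norm (k *: v) = `|k| * cmodule_norm v.
Proof.
by rewrite /cmodule_norm mulr_sumr; apply: eq_bigr => A _; rewrite ffunE normrZ.
Qed.

Lemma cmodule_norm0_eq0 v : cmodule_norm v = 0 -> v = 0.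
Proof.
move=> /eqP; rewrite psumr_eq0 // => /allP v0; apply/ffunP => A.
by have /= := v0 A (mem_index_enum A); rewrite normr_eq0 ffunE => /eqP.
Qed.

HB.instance Definition _ := Lmodule_isNormed.Build R (cmodule V n)
  cmodule_normD cmodule_normZ cmodule_norm0_eq0.

Lemma cmodule_normE v : `|v| = \sum_A `|v A|.
Proof. by []. Qed.

Definition tens x b : cmodule V n := [ffun A => b A *: x].

Definition lact a v : cmodule V n := \sum_A tens (v A) (a * cbasis R A).

Definition ract v a : cmodule V n := \sum_A tens (v A) (cbasis R A * a).

Lemma tensDl x y b : tens (x + y) b = tens x b + tens y b.
Proof. by apply/ffunP => A; rewrite !ffunE scalerDr. Qed.

Lemma tensZl k x b : tens (k *: x) b = k *: tens x b.
Proof. by apply/ffunP => A; rewrite !ffunE !scalerA mulrC. Qed.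

Lemma tensDr x b c : tens x (b + c) = tens x b + tens x c.
Proof. by apply/ffunP => A; rewrite !ffunE scalerDl. Qed.

Lemma tensZr k x b : tens x (k *: b) = k *: tens x b.
Proof. by apply/ffunP => A; rewrite !ffunE scalerA. Qed.

Lemma tens_sumr I (s : seq I) x (f : I -> clifford R n) :
  tens x (\sum_(i <- s) f i) = \sum_(i <- s) tens x (f i).
Proof.
apply: (big_morph (tens x)) => [b c|]; first exact: tensDr.
by rewrite -[in LHS](scale0r 0) tensZr scale0r.
Qed.

Lemma tens_basisE v : v = \sum_A tens (v A) (cbasis R A).
Proof.
apply/ffunP => B; rewrite sum_ffunE (bigD1 B) //= big1 ?addr0.
  by rewrite !ffunE eqxx scale1r.
by move=> A /negPf AB; rewrite !ffunE AB scale0r.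
Qed.

Lemma lactDr a v w : lact a (v + w) = lact a v + lact a w.
Proof.
by rewrite /lact -big_split; apply: eq_bigr => A _; rewrite ffunE tensDl.
Qed.

Lemma lactDl a b v : lact (a + b) v = lact a v + lact b v.
Proof.
by rewrite /lact -big_split; apply: eq_bigr => A _; rewrite mulrDl tensDr.
Qed.

Lemma ractDl v w a : ract (v + w) a = ract v a + ract w a.
Proof.
by rewrite /ract -big_split; apply: eq_bigr => A _; rewrite ffunE tensDl.
Qed.

Lemma ractZl k v a : ract (k *: v) a = k *: ract v a.
Proof.
by rewrite /ract scaler_sumr; apply: eq_bigr => A _; rewrite ffunE tensZl.
Qed.

Lemma ract0l a : ract 0 a = 0.
Proof. by rewrite -[in LHS](scale0r 0) ractZl scale0r. Qed.

Lemma ract_suml I (s : seq I) (f : I -> cmodule V n) a :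
  ract (\sum_(i <- s) f i) a = \sum_(i <- s) ract (f i) a.
Proof.
apply: (big_morph (ract^~ a)) => [v w|]; [exact: ractDl | exact: ract0l].
Qed.

Lemma lact_sumr I (s : seq I) (f : I -> cmodule V n) a :
  lact a (\sum_(i <- s) f i) = \sum_(i <- s) lact a (f i).
Proof.
apply: (big_morph (lact a)) => [v w|]; first exact: lactDr.
by apply: (@addrI _ (lact a 0)); rewrite -lactDr !addr0.
Qed.

Lemma lact_tens a x b : lact a (tens x b) = tens x (a * b).
Proof.
rewrite [in RHS](cbasisE b) mulr_sumr tens_sumr; apply: eq_bigr => A _.
by rewrite ffunE -scalerAr tensZr tensZl.
Qed.

Lemma ract_tens x b a : ract (tens x b) a = tens x (b * a).
Proof.
rewrite [in RHS](cbasisE b) mulr_suml tens_sumr; apply: eq_bigr => A _.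
by rewrite ffunE -scalerAl tensZr tensZl.
Qed.

Lemma lact1 v : lact 1 v = v.
Proof.
by rewrite /lact [RHS]tens_basisE; apply: eq_bigr => A _; rewrite mul1r.
Qed.

Lemma lactA a b v : lact a (lact b v) = lact (a * b) v.
Proof.
by rewrite lact_sumr; apply: eq_bigr => A _; rewrite lact_tens mulrA.
Qed.

Lemma ract_alg v k : ract v k%:A = k *: v.
Proof.
rewrite [in RHS](tens_basisE v) scaler_sumr; apply: eq_bigr => A _.
by rewrite -scalerAr mulr1 tensZr.
Qed.

Lemma lact_alg v k : lact k%:A v = k *: v.
Proof.
rewrite [in RHS](tens_basisE v) scaler_sumr; apply: eq_bigr => A _.
by rewrite -scalerAl mul1r tensZr.
Qed.

Lemma lact_ract a v b : lact a (ract v b) = ract (lact a v) b.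
Proof.
rewrite lact_sumr ract_suml; apply: eq_bigr => A _.
by rewrite lact_tens ract_tens mulrA.
Qed.

Lemma normr_tens x b : `|tens x b| = (\sum_A `|b A|) * `|x|.
Proof.
by rewrite cmodule_normE mulr_suml; apply: eq_bigr => A _; rewrite ffunE normrZ.
Qed.

Lemma lact_bounded a : bounded_map (lact a).
Proof.
exists (\sum_A \sum_B `|(a * cbasis R A : clifford R n) B|) => v.
rewrite mulr_suml (le_trans (ler_norm_sum _ _ _))//; apply: ler_sum => A _.
rewrite normr_tens ler_wpM2l ?sumr_ge0 //.
by rewrite cmodule_normE (bigD1 A) //= lerDl sumr_ge0.
Qed.

End CliffordModule.

(* B(V_n): bounded right linear operators.  Linearity over R follows from right_linear with a = k%:A. *)
Record rlop (R : realType) (V : normedModType R) (n : nat) := Rlop {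
  rlop_fun :> cmodule V n -> cmodule V n;
  rlop_add : forall v w, rlop_fun (v + w) = rlop_fun v + rlop_fun w;
  rlop_ract : forall v a, rlop_fun (ract v a) = ract (rlop_fun v) a;
  rlop_bounded : bounded_map rlop_fun }.

Section OperatorRing.
Variables (R : realType) (V : normedModType R) (n : nat).
Implicit Types (S T U : rlop V n) (a b : clifford R n) (v w : cmodule V n).

HB.instance Definition _ := gen_eqMixin (rlop V n).
HB.instance Definition _ := gen_choiceMixin (rlop V n).

Lemma rlopP S T : (forall v, S v = T v) -> S = T.
Proof.
case: S T => [f fD fr fb] [g gD gr gb] /= fg.
have {}fg : f = g by apply/funext.
by case: _ / fg gD gr gb => *; congr Rlop; apply: Prop_irrelevance.
Qed.

Program Definition rlop0 : rlop V n := @Rlop _ _ _ (fun=> 0) _ _ _.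
Next Obligation. by move=> *; rewrite /= addr0. Qed.
Next Obligation. by move=> *; rewrite /= ract0l. Qed.
Next Obligation. by exists 0 => v; rewrite /= normr0 mul0r. Qed.

Program Definition rlop1 : rlop V n := @Rlop _ _ _ id _ _ _.
Next Obligation. by []. Qed.
Next Obligation. by []. Qed.
Next Obligation. by exists 1 => v; rewrite mul1r. Qed.

Program Definition rlopD S T : rlop V n :=
  @Rlop _ _ _ (fun v => S v + T v) _ _ _.
Next Obligation. by move=> S T v w; rewrite /= !rlop_add addrACA. Qed.
Next Obligation. by move=> S T v a; rewrite /= !rlop_ract ractDl. Qed.
Next Obligation.
move=> S T; have [[M SM] [N TN]] := (rlop_bounded S, rlop_bounded T).
by exists (M + N) => v /=; rewrite (le_trans (ler_normD _ _))// mulrDl lerD.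
Qed.

Program Definition rlopZ (k : R) T : rlop V n :=
  @Rlop _ _ _ (fun v => k *: T v) _ _ _.
Next Obligation. by move=> k T v w; rewrite /= rlop_add scalerDr. Qed.
Next Obligation. by move=> k T v a; rewrite /= rlop_ract ractZl. Qed.
Next Obligation.
move=> k T; have [M TM] := rlop_bounded T; exists (`|k| * M) => v /=.
by rewrite normrZ -mulrA ler_wpM2l.
Qed.

Program Definition rlopM S T : rlop V n :=
  @Rlop _ _ _ (fun v => S (T v)) _ _ _.
Next Obligation. by move=> S T v w; rewrite /= !rlop_add. Qed.
Next Obligation. by move=> S T v a; rewrite /= !rlop_ract. Qed.
Next Obligation.
move=> S T; have [[M SM] [N TN]] := (rlop_bounded S, rlop_bounded T).
exists (`|M| * N) => v /=; rewrite (le_trans (SM _))// -mulrA.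
by rewrite (le_trans (ler_wpM2r _ (ler_norm M)))// ler_wpM2l.
Qed.

Definition rlopN T : rlop V n := rlopZ (-1) T.

Lemma rlopDA : associative rlopD.
Proof. by move=> S T U; apply: rlopP => v; rewrite /= addrA. Qed.

Lemma rlopDC : commutative rlopD.
Proof. by move=> S T; apply: rlopP => v; rewrite /= addrC. Qed.

Lemma rlop0D : left_id rlop0 rlopD.
Proof. by move=> T; apply: rlopP => v; rewrite /= add0r. Qed.

Lemma rlopND : left_inverse rlop0 rlopN rlopD.
Proof. by move=> T; apply: rlopP => v; rewrite /= scaleN1r addNr. Qed.

HB.instance Definition _ :=
  GRing.isZmodule.Build (rlop V n) rlopDA rlopDC rlop0D rlopND.

Lemma rlopMA : associative rlopM.
Proof. by move=> S T U; apply: rlopP. Qed.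

Lemma rlop1M : left_id rlop1 rlopM.
Proof. by move=> T; apply: rlopP. Qed.

Lemma rlopM1 : right_id rlop1 rlopM.
Proof. by move=> T; apply: rlopP. Qed.

Lemma rlopMDl : left_distributive rlopM +%R.
Proof. by move=> S T U; apply: rlopP. Qed.

Lemma rlopMDr : right_distributive rlopM +%R.
Proof. by move=> S T U; apply: rlopP => v; exact: rlop_add. Qed.

HB.instance Definition _ := GRing.Zmodule_isPzRing.Build (rlop V n)
  rlopMA rlop1M rlopM1 rlopMDl rlopMDr.

Lemma rlopZA (k l : R) T : rlopZ k (rlopZ l T) = rlopZ (k * l) T.
Proof. by apply: rlopP => v; rewrite /= scalerA. Qed.

Lemma rlop1Z : left_id 1 rlopZ.
Proof. by move=> T; apply: rlopP => v; rewrite /= scale1r. Qed.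

Lemma rlopZDr : right_distributive rlopZ +%R.
Proof. by move=> k S T; apply: rlopP => v; rewrite /= scalerDr. Qed.

Lemma rlopZDl T : {morph rlopZ^~ T : k l / k + l}.
Proof. by move=> k l; apply: rlopP => v; rewrite /= scalerDl. Qed.

HB.instance Definition _ := GRing.Zmodule_isLmodule.Build R (rlop V n)
  rlopZA rlop1Z rlopZDr rlopZDl.

Program Definition rlop_of_clifford a : rlop V n :=
  @Rlop _ _ _ (lact a) _ _ (lact_bounded V a).
Next Obligation. by move=> a v w; rewrite /= lactDr. Qed.
Next Obligation. by move=> a v b; rewrite /= lact_ract. Qed.

Definition opL a T : rlop V n := rlop_of_clifford a * T.

Definition opR T a : rlop V n := T * rlop_of_clifford a.

Lemma opLE a T v : opL a T v = lact a (T v).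
Proof. by []. Qed.

Lemma opRE T a v : opR T a v = T (lact a v).
Proof. by []. Qed.

Definition is_inverse S T := S * T = 1 /\ T * S = 1.

Definition invertible T := exists S, is_inverse T S.

(* The inverse of T, and 0 when T is not invertible. *)
Definition inv_op T : rlop V n := xget 0 [set S | is_inverse T S].

(* B(V) acting on V_n = V (x) R_n through the first factor. *)
Program Definition componentwise (f : {linear V -> V}) (fb : bounded_map f) :
  rlop V n := @Rlop _ _ _ (fun v => [ffun A => f (v A)] : cmodule V n) _ _ _.
Next Obligation.
by move=> f _ v w; apply/ffunP => A; rewrite /= !ffunE linearD.
Qed.
Next Obligation.
move=> f _ v a; apply/ffunP => A; rewrite ffunE !sum_ffunE raddf_sum.
by apply: eq_bigr => B _; rewrite !ffunE; exact: linearZ.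
Qed.
Next Obligation.
move=> f [M fM]; exists M => v /=; rewrite !cmodule_normE mulr_sumr.
by apply: ler_sum => A _; rewrite ffunE.
Qed.

End OperatorRing.

Infix "*:l" := opL (at level 40, left associativity) : ring_scope.
Infix "*:r" := opR (at level 40, left associativity) : ring_scope.

(* T = T_0 + \sum_l e_l T_l is carried by its commuting components, which it
   determines; as an operator on V_n it is bc_op T. *)
Record BC01 (R : realType) (V : normedModType R) (n : nat) := BC01_of {
  bc_comp : 'I_n.+1 -> {linear V -> V};
  bc_bounded : forall l, bounded_map (bc_comp l);
  bc_comm : forall l m x, bc_comp l (bc_comp m x) = bc_comp m (bc_comp l x) }.

Section FunctionalCalculus.
Variables (R : realType) (V : normedModType R) (n : nat).
Implicit Types (T : BC01 V n) (s : paravector R n).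

Definition comp_op T l : rlop V n := componentwise n (bc_bounded T l).

Definition bc_op T : rlop V n :=
  comp_op T ord0 + \sum_(l < n) cgen R l *:l comp_op T (lift ord0 l).

Definition conj_op T : rlop V n :=
  comp_op T ord0 - \sum_(l < n) cgen R l *:l comp_op T (lift ord0 l).

Lemma op_of_cliffordM (a b : clifford R n) :
  rlop_of_clifford V (a * b) = rlop_of_clifford V a * rlop_of_clifford V b.
Proof. by apply: rlopP => v; rewrite /= -lactA. Qed.

Lemma op_of_cliffordD (a b : clifford R n) :
  rlop_of_clifford V (a + b) = rlop_of_clifford V a + rlop_of_clifford V b.
Proof. by apply: rlopP => v; exact: lactDl. Qed.

Lemma op_of_clifford_alg (k : R) :
  rlop_of_clifford V (k%:A : clifford R n) = k *: (1 : rlop V n).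
Proof. by apply: rlopP => v; exact: lact_alg. Qed.

Lemma comp_opC T l m : comp_op T l * comp_op T m = comp_op T m * comp_op T l.
Proof.
by apply: rlopP => v; apply/ffunP => A; rewrite /= !ffunE bc_comm.
Qed.

Lemma comp_op_clifford T l (a : clifford R n) :
  comp_op T l * rlop_of_clifford V a = rlop_of_clifford V a * comp_op T l.
Proof.
apply: rlopP => v; apply/ffunP => A; rewrite /= ffunE !sum_ffunE raddf_sum.
by apply: eq_bigr => B _; rewrite !ffunE; exact: linearZ.
Qed.

Lemma op_add_conj T : bc_op T + conj_op T = 2 *: comp_op T ord0.
Proof. by rewrite /bc_op /conj_op addrACA subrr addr0 scaler_nat mulr2n. Qed.

Lemma op_mul_conj T : bc_op T * conj_op T = \sum_l comp_op T l ^+ 2.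
Proof.
set t := fun l => comp_op T (lift ord0 l).
set S := \sum_(l < n) cgen R l *:l t l.
have tS : comp_op T ord0 * S = S * comp_op T ord0.
  rewrite mulr_sumr mulr_suml; apply: eq_bigr => l _.
  by rewrite /opL mulrA comp_op_clifford -!mulrA comp_opC.
have SE : S * S = - \sum_l t l ^+ 2.
  have E : S * S = \sum_l \sum_m
      rlop_of_clifford V (cgen R l * cgen R m) * (t l * t m).
    rewrite mulr_suml; apply: eq_bigr => l _; rewrite mulr_sumr.
    apply: eq_bigr => m _; rewrite /opL op_of_cliffordM !mulrA.
    by congr (_ * _); rewrite -!mulrA comp_op_clifford.
  have E2 : S * S + S * S = - \sum_l t l ^+ 2 + - \sum_l t l ^+ 2.
    rewrite {1}E E [X in _ + X]exchange_big -big_split -!sumrN -big_split /=.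
    apply: eq_bigr => l _; rewrite -big_split (bigD1 l) //= big1 => [|m ml].
      rewrite addr0 -expr2 gen_sqr -scaleN1r op_of_clifford_alg.
      have -> : -1 *: (1 : rlop V n) = - 1 by rewrite scaleN1r.
      by rewrite mulN1r expr2.
    rewrite [t m * t l]comp_opC -mulrDl -op_of_cliffordD gen_anticomm.
      by rewrite -[0](scale0r 1) op_of_clifford_alg scale0r mul0r.
    by rewrite eq_sym.
  apply: (@scalerI _ _ (2 : R)); first by rewrite pnatr_eq0.
  by rewrite !scaler_nat !mulr2n.
rewrite /bc_op /conj_op -/S mulrBr !mulrDl tS opprD addrA addrK SE.
by rewrite opprK big_ord_recl expr2.
Qed.

Definition pencil s T : rlop V n :=
  (pcliff s ^+ 2) *:l 1 - pcliff s *:l (bc_op T + conj_op T) + bc_op T * conj_op T.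

Definition rhoF T : set (paravector R n) := [set s | invertible (pencil s T)].

Definition Qinv s T : rlop V n := inv_op (pencil s T).

Definition SLinv s T : rlop V n := (pcliff s *:l 1 - conj_op T) * Qinv s T.

Definition SRinv s T : rlop V n := Qinv s T * (pcliff s *:l 1 - conj_op T).

End FunctionalCalculus.

Definition gamma5 (R : realType) : R := 2 ^+ 4 * (2`!%:R) ^+ 2.

Definition F5L (R : realType) (V : normedModType R) (s : paravector R 5)
    (T : BC01 V 5) : rlop V 5 :=
  gamma5 R *: ((pcliff s *:l 1 - conj_op T) * Qinv s T ^+ 3).

Definition F5R (R : realType) (V : normedModType R) (s : paravector R 5)
    (T : BC01 V 5) : rlop V 5 :=
  gamma5 R *: (Qinv s T ^+ 3 * (pcliff s *:l 1 - conj_op T)).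

(* Main.v *)
Require Import Defs.
From mathcomp Require Import all_boot all_order all_algebra all_field.
From mathcomp Require Import all_classical all_reals all_analysis.
From mathcomp Require Import ring lra.
Import Order.TTheory GRing.Theory Num.Theory numFieldNormedType.Exports.

Local Open Scope classical_set_scope.
Local Open Scope ring_scope.

(** Write x for the operator T, z for its conjugate, and regard paravectors as
    operators on the module.  The components of T commute with each other and
    with the Clifford numbers, so x + z = 2 T_0 and x z = z x = the sum of the
    T_l^2 commute with every Clifford number, and the pencil
    P_s = s^2 - s (x + z) + x z factors as s (s - z) - (s - z) x as well as
    (s - z) s - x (s - z).  Multiplying by powers of q = P_s^-1, respectively
    of r = P_p^-1, gives the intertwining relations

      s q^i (s - z) = q^i (s - z) x + q^(i-1),
      (p - z) r^j p = x (p - z) r^j + r^(j-1).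

    For the operator d(y) = s y - y p, the terms in x therefore cancel in
    d (q^i (s - z) (p - z) r^j) = q^(i-1) (p - z) r^j - q^i (s - z) r^(j-1).
    Let y be the left-hand side of the theorem divided by gamma_5.  Its terms
    of this form have (i, j) = (3, 1), (2, 2), (1, 3), and their images under
    d telescope up to the images of q^2 r and q r^2, which the last bracket of
    the theorem supplies: d(y) = (p - z) r^3 - q^3 (s - z)
    ([resolvent_sum_commutator]).

    The polynomial D = p^2 - 2 s_0 p + |s|^2 appears because s and its
    conjugate c satisfy s + c = 2 s_0 and c s = |s|^2, which makes
    y D = c d(y) - d(y) p ([quadratic_commutator]).  This is the asserted
    identity multiplied by D on the right.  Finally D is invertible off the
    sphere [p]: it has the form a p + b with real a and b, so that its product
    with a (conjugate of p) + b is a real number, and this number vanishes only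
    if s_0 = p_0 and the vector parts of s and p have the same length
    ([sphere_polynomial_unit]). *)

(** * Intertwining identities in a noncommutative ring *)

Section Intertwining.
Context {A : pzRingType}.
Implicit Types s c p x z q y : A.

(** The two terms in x cancel because a * x * b can be read from either side;
    only the defects a' and b' of the intertwining relations remain. *)
Lemma commutator_intertwine {s p x a b a' b' : A} :
  s * a = a * x + a' -> b * p = x * b + b' ->
  s * (a * b) - a * b * p = a' * b - a * b'.
Proof.
move=> sa bp; rewrite mulrA sa -[a * b * p]mulrA bp mulrDl mulrDr -mulrA.
by rewrite opprD addrACA subrr add0r.
Qed.

(** Here q is a one-sided inverse of one factorization of the pencil.  Only s
    commutes with q, so s is moved across q while z and x stay in place. *)
Lemma intertwine_right {s x z q : A} (k : nat) :
  q * (s * (s - z) - (s - z) * x) = 1 -> s * q = q * s ->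
  s * (q ^+ k.+1 * (s - z)) = q ^+ k.+1 * (s - z) * x + q ^+ k.
Proof.
move=> qP sq; have sqk : s * q ^+ k.+1 = q ^+ k.+1 * s by apply: commrX.
apply/eqP; rewrite [eqbRHS]addrC -subr_eq mulrA sqk -!mulrA -mulrBr exprSr.
by rewrite -mulrA qP mulr1.
Qed.

Lemma intertwine_left {p x z q : A} (k : nat) :
  ((p - z) * p - x * (p - z)) * q = 1 -> p * q = q * p ->
  (p - z) * q ^+ k.+1 * p = x * ((p - z) * q ^+ k.+1) + q ^+ k.
Proof.
move=> Pq pq; have pqk : p * q ^+ k.+1 = q ^+ k.+1 * p by apply: commrX.
apply/eqP; rewrite [eqbRHS]addrC -subr_eq -[_ * _ * p]mulrA -pqk !mulrA -mulrBl.
by rewrite exprS mulrA Pq mul1r.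
Qed.

(** For c the conjugate of s, s + c and c * s are real numbers, and the left-hand
    side becomes y * (p^2 - 2 s_0 p + |s|^2).  The identity is the factorization
    t^2 - (s + c) t + c s = (t - c)(t - s), t being right multiplication by p,
    which commutes with the left multiplications by s and c. *)
Lemma quadratic_commutator s c p y :
  y * p ^+ 2 - (s + c) * (y * p) + c * s * y
    = c * (s * y - y * p) - (s * y - y * p) * p.
Proof.
rewrite expr2 mulrBr mulrBl mulrDl opprD opprB !mulrA [RHS]addrC.
rewrite -!addrA; congr (_ + _); rewrite [RHS]addrCA [in RHS]addrC -addrA.
by congr (_ + _); rewrite addrC.
Qed.

(** The images of the five terms under y |-> s * y - y * p telescope.  The
    correction q ^+ 2 * r + q * r ^+ 2 enters because its image involves
    s - p = (s - z) - (p - z), in which the two parts are exactly those left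
    over by the three products. *)
Lemma resolvent_sum_commutator {s z p q r x : A} :
  s * q = q * s -> p * r = r * p ->
  q * (s * (s - z) - (s - z) * x) = 1 ->
  ((p - z) * p - x * (p - z)) * r = 1 ->
  let y := q ^+ 3 * (s - z) * ((p - z) * r) + q * (s - z) * ((p - z) * r ^+ 3)
    + q ^+ 2 * (s - z) * ((p - z) * r ^+ 2) + (q ^+ 2 * r + q * r ^+ 2) in
  s * y - y * p = (p - z) * r ^+ 3 - q ^+ 3 * (s - z).
Proof.
move=> sq pr qP Pr /=.
pose d y := s * y - y * p.
have dD u v : d (u + v) = d u + d v.
  by rewrite /d mulrDr mulrDl opprD addrACA.
have d1 i j : d (q ^+ i.+1 * (s - z) * ((p - z) * r ^+ j.+1))
    = q ^+ i * ((p - z) * r ^+ j.+1) - q ^+ i.+1 * (s - z) * r ^+ j.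
  have qi := intertwine_right i qP sq; have rj := intertwine_left j Pr pr.
  exact: commutator_intertwine qi rj.
have d2 i j : d (q ^+ i * r ^+ j)
    = q ^+ i * (s - z) * r ^+ j - q ^+ i * ((p - z) * r ^+ j).
  have sqi : s * q ^+ i = q ^+ i * s by apply: commrX.
  have prj : p * r ^+ j = r ^+ j * p by apply: commrX.
  rewrite /d mulrA sqi -[_ * _ * p]mulrA -prj !mulrA -!mulrBl -!mulrBr.
  by rewrite opprB subrKA.
rewrite -/(d _) !dD (d1 2 0) (d1 0 2) (d1 1 1) (d2 2 1) (d2 1 2).
rewrite !expr0 !expr1 !mul1r !mulr1.
rewrite -[LHS]addrA [X in _ + X]addrA subrKA [_ - _ + (_ - q * _)]addrC subrKA.
by rewrite -addrA subrKA addrC subrKA.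
Qed.

End Intertwining.

(** * Paravectors and the sphere of p *)

Section Paravectors.
Context {R : realType} {n : nat}.
Implicit Types x p s : paravector R n.

(** Adding the square to itself with the summation indices exchanged makes the
    anticommutators of the generators appear; hence the factor 2. *)
Lemma sqr_vector_part (a : 'I_n -> R) :
  (\sum_j a j *: cgen R j) ^+ 2 = - (\sum_j a j ^+ 2)%:A :> clifford R n.
Proof.
set S := \sum_j _.
have SS : S ^+ 2 = \sum_l \sum_m (a l * a m) *: (cgen R l * cgen R m).
  rewrite expr2 mulr_suml; apply: eq_bigr => l _; rewrite mulr_sumr.
  by apply: eq_bigr => m _; rewrite -scalerAl -scalerAr scalerA.
have two (b : clifford R n) : b + b = 2 *: b by rewrite scaler_nat mulr2n.
apply: (@scalerI _ _ (2 : R)); first by rewrite pnatr_eq0.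
rewrite -!two {1}SS SS [X in _ + X]exchange_big -big_split /=.
rewrite scaler_suml -sumrN -big_split /=.
apply: eq_bigr => l _; rewrite -big_split (bigD1 l) //= big1 => [|m ml].
  by rewrite addr0 -!expr2 gen_sqr scalerN.
by rewrite [a m * a l]mulrC -scalerDr gen_anticomm ?scaler0 // eq_sym.
Qed.

Lemma pre_pvec x : pre (pvec x) = 0.
Proof. by rewrite /pvec /pre !mxE eqxx mulr1 subrr. Qed.

Lemma pvec_lift x j : pvec x 0 (lift ord0 j) = x 0 (lift ord0 j).
Proof. by rewrite /pvec !mxE /= mulr0 subr0. Qed.

Lemma pre_pconj x : pre (pconj x) = pre x.
Proof. by rewrite /pconj /pvec /pre !mxE eqxx !mulr1 subrr subr0. Qed.

Lemma pcliff_pconj x :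
  pcliff (pconj x) = (pre x)%:A - \sum_(j < n) x 0 (lift ord0 j) *: cgen R j.
Proof.
rewrite /pcliff pre_pconj; congr (_ + _).
rewrite -sumrN; apply: eq_bigr => j _.
by rewrite /pconj mxE [X in _ + X]mxE pvec_lift !mxE /= mulr0 add0r scaleNr.
Qed.

Lemma pcliffD_pconj x : pcliff x + pcliff (pconj x) = (2 * pre x)%:A.
Proof.
by rewrite pcliff_pconj /pcliff addrACA subrr addr0 -scalerDl mulr_natl mulr2n.
Qed.

Lemma sqr_pabs x : pabs x ^+ 2 = \sum_j x 0 j ^+ 2.
Proof. by rewrite sqr_sqrtr // sumr_ge0 // => j _; exact: sqr_ge0. Qed.

Lemma sqr_pabs_pvec x :
  pabs (pvec x) ^+ 2 = \sum_(j < n) x 0 (lift ord0 j) ^+ 2.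
Proof.
rewrite sqr_pabs big_ord_recl -/(pre (pvec x)) pre_pvec expr0n add0r.
by apply: eq_bigr => j _; rewrite pvec_lift.
Qed.

Lemma sqr_pabs_split x : pabs x ^+ 2 = pre x ^+ 2 + pabs (pvec x) ^+ 2.
Proof. by rewrite sqr_pabs_pvec sqr_pabs big_ord_recl. Qed.

Lemma mul_pcliff_pconj x : pcliff x * pcliff (pconj x) = (pabs x ^+ 2)%:A.
Proof.
rewrite pcliff_pconj /pcliff; set v := \sum_j _.
rewrite mulrDl !mulrBr -!scalerAl -!scalerAr !mul1r mulr1 addrA subrK.
rewrite -expr2 sqr_vector_part opprK scalerA -expr2 -scalerDl.
by rewrite sqr_pabs_split sqr_pabs_pvec.
Qed.

Lemma mul_pconj_pcliff x : pcliff (pconj x) * pcliff x = (pabs x ^+ 2)%:A.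
Proof.
have xE : pcliff x = (2 * pre x)%:A - pcliff (pconj x).
  by rewrite -pcliffD_pconj addrK.
rewrite -mul_pcliff_pconj xE mulrBr mulrBl -!scalerAl -!scalerAr.
by rewrite mul1r mulr1.
Qed.

End Paravectors.

(** The points of [p] are those with the scalar part of p and the length of its
    vector part.  The dimension is positive so that a direction J still exists
    when the vector part vanishes. *)
Lemma psphere_intro {R : realType} {n : nat} {p s : paravector R n.+1} :
  pre s = pre p -> pabs (pvec s) = pabs (pvec p) -> psphere p s.
Proof.
move=> s0 sr; rewrite /psphere /unit_imaginary /=.
have sE : s = pre s *: delta_mx 0 ord0 + pvec s by rewrite addrC subrK.
have [r0|r0] := eqVneq (pabs (pvec s)) 0.
  have v0 : pvec s = 0.
    apply/rowP => j; have /eqP := sqr_pabs (pvec s).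
    rewrite r0 expr0n eq_sym psumr_eq0 => [/allP/(_ j (mem_index_enum j))|k _].
      by rewrite /= sqrf_eq0 => /eqP ->; rewrite mxE.
    exact: sqr_ge0.
  exists (delta_mx 0 (lift ord0 ord0)); last first.
    by rewrite -sr r0 scale0r -s0 [RHS]sE v0.
  split; first by rewrite /pre mxE.
  rewrite /pabs (bigD1 (lift ord0 ord0)) //= big1.
    by rewrite mxE !eqxx addr0 expr1n sqrtr1.
  by move=> j /negPf jl; rewrite mxE jl andbF expr0n.
exists ((pabs (pvec s))^-1 *: pvec s); last first.
  by rewrite -sr scalerA mulfV // scale1r -s0 [RHS]sE.
split; first by rewrite /pre mxE -/(pre (pvec s)) pre_pvec mulr0.
set r := pabs _ in r0 *.
rewrite -[LHS]ger0_norm ?sqrtr_ge0 // -sqrtr_sqr sqr_pabs.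
under eq_bigr do rewrite mxE exprMn.
by rewrite -mulr_sumr -sqr_pabs -exprMn mulVf // expr1n sqrtr1.
Qed.

(** With x, y the scalar parts of p, s and u, v the squared lengths of their
    vector parts, the left-hand side is the squared norm of
    p^2 - 2 s_0 p + |s|^2.  It equals
    ((x - y)^2 + v - u)^2 + 4 (x - y)^2 u, a sum of nonnegative terms. *)
Lemma sphere_polynomial_norm_eq0 {R : realType} {x y u v : R} :
  0 <= u -> 0 <= v ->
  (2 * (x - y)) ^+ 2 * (x ^+ 2 + u)
    + 2 * (x - y) * (y ^+ 2 + v - (x ^+ 2 + u)) * (2 * x)
    + (y ^+ 2 + v - (x ^+ 2 + u)) ^+ 2 = 0 ->
  y = x /\ v = u.
Proof.
move=> u0 v0 c0; set d := x - y.
have cE : (d ^+ 2 + v - u) ^+ 2 + 4 * (d ^+ 2 * u) = 0.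
  by rewrite -[RHS]c0 /d; ring.
have d2u0 : 0 <= d ^+ 2 * u by rewrite mulr_ge0 ?sqr_ge0.
have w0 : 0 <= (d ^+ 2 + v - u) ^+ 2 by apply: sqr_ge0.
have duv : d ^+ 2 + v - u = 0.
  by apply/eqP; rewrite -sqrf_eq0 eq_le w0 andbT; lra.
have /eqP : d ^+ 2 * u = 0 by lra.
have d20 : 0 <= d ^+ 2 by apply: sqr_ge0.
rewrite mulf_eq0 => dOu; have /eqP : d ^+ 2 = 0.
  by case/orP: dOu => /eqP // uE; lra.
by rewrite sqrf_eq0 => /eqP dE; move: duv dE; rewrite /d => duv dE; split; nra.
Qed.

(** Since p^2 = 2 p_0 p - |p|^2, the polynomial is a real affine combination
    a p + b; its inverse is a real multiple of the same combination of the
    conjugate of p. *)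
Lemma sphere_polynomial_unit {R : realType} {n : nat}
    {p s : paravector R n.+1} :
  ~ psphere p s ->
  (pcliff p ^+ 2 - (2 * pre s) *: pcliff p + (pabs s ^+ 2)%:A : clifford R n.+1)
    \is a GRing.unit.
Proof.
move=> ps.
set a := 2 * (pre p - pre s); set b := pabs s ^+ 2 - pabs p ^+ 2.
(* The product (a p + b) (a pbar + b), from p pbar = |p|^2, p + pbar = 2 p_0. *)
set c := a ^+ 2 * pabs p ^+ 2 + a * b * (2 * pre p) + b ^+ 2.
have -> : pcliff p ^+ 2 - (2 * pre s) *: pcliff p + (pabs s ^+ 2)%:A
    = a *: pcliff p + b%:A.
  have pE : pcliff p = (2 * pre p)%:A - pcliff (pconj p).
    by rewrite -pcliffD_pconj addrK.
  rewrite expr2 {2}pE mulrBr mul_pcliff_pconj -scalerAr mulr1 [_ - _ - _]addrAC.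
  by rewrite -scalerBl -mulrBr /b scalerBl -addrA [- _ + _]addrC.
have c0 : c != 0.
  apply/eqP => c0.
  have [] := @sphere_polynomial_norm_eq0 R (pre p) (pre s)
    (pabs (pvec p) ^+ 2) (pabs (pvec s) ^+ 2).
  - exact: sqr_ge0.
  - exact: sqr_ge0.
  - by rewrite -(sqr_pabs_split p) -(sqr_pabs_split s).
  - move=> sp0 spv; apply: ps; apply: psphere_intro sp0 _.
    by apply/eqP; rewrite -(@eqrXn2 _ 2) ?sqrtr_ge0 // spv.
have Dc (x y : paravector R n.+1) : pcliff x * pcliff y = (pabs p ^+ 2)%:A ->
    pcliff x + pcliff y = (2 * pre p)%:A ->
    (a *: pcliff x + b%:A) * (a *: pcliff y + b%:A) = c%:A.
  move=> xy xDy; rewrite mulrDl !mulrDr -!scalerAl -!scalerAr xy !mul1r mulr1.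
  rewrite !scalerA addrA -[X in X + _]addrA [b * a]mulrC -scalerDr xDy.
  by rewrite !scalerA -!scalerDl -!expr2.
have pq := Dc _ _ (mul_pcliff_pconj p) (pcliffD_pconj p).
have qp := Dc _ _ (mul_pconj_pcliff p) (etrans (addrC _ _) (pcliffD_pconj p)).
apply/unitrP; exists (c^-1 *: (a *: pcliff (pconj p) + b%:A)).
by rewrite -scalerAl -scalerAr pq qp scalerA mulVf // scale1r.
Qed.

(** * The pencil of a paravector operator *)

Section Operators.
Context {R : realType} {V : normedModType R} {n : nat}.
Implicit Types (T : BC01 V n) (s : paravector R n) (a : clifford R n).

Local Notation cop := (@rlop_of_clifford R V n).

Lemma rlop_scaleAl (k : R) (X Y : rlop V n) : k *: (X * Y) = (k *: X) * Y.
Proof. exact: rlopP. Qed.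

Lemma rlop_scaleAr (k : R) (X Y : rlop V n) : k *: (X * Y) = X * (k *: Y).
Proof.
by apply: rlopP => v /=; rewrite -(ract_alg (Y v)) rlop_ract ract_alg.
Qed.

Lemma rlop_of_clifford1 : cop 1 = 1.
Proof. by apply: rlopP => v; exact: lact1. Qed.

Lemma op_of_cliffordZ (k : R) a : cop (k *: a) = k *: cop a.
Proof.
rewrite -[a in LHS]mul1r scalerAl op_of_cliffordM op_of_clifford_alg.
by rewrite -rlop_scaleAl mul1r.
Qed.

Lemma comp0_conj_op T :
  comp_op T ord0 * conj_op T = conj_op T * comp_op T ord0.
Proof.
rewrite /conj_op mulrBr mulrBl; congr (_ - _).
rewrite mulr_sumr mulr_suml; apply: eq_bigr => l _.
by rewrite /opL mulrA comp_op_clifford -!mulrA comp_opC.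
Qed.

Lemma bc_opE T : bc_op T = 2 *: comp_op T ord0 - conj_op T.
Proof. by rewrite -op_add_conj addrK. Qed.

Lemma conj_op_mul T : conj_op T * bc_op T = bc_op T * conj_op T.
Proof.
rewrite bc_opE; move: (conj_op T) (comp0_conj_op T) => z tz.
by rewrite mulrBr mulrBl -(rlop_scaleAr 2) -(rlop_scaleAl 2) tz.
Qed.

Lemma trace_clifford T a :
  (bc_op T + conj_op T) * cop a = cop a * (bc_op T + conj_op T).
Proof.
by rewrite op_add_conj -(rlop_scaleAl 2) -(rlop_scaleAr 2) comp_op_clifford.
Qed.

Lemma norm_clifford T a :
  bc_op T * conj_op T * cop a = cop a * (bc_op T * conj_op T).
Proof.
rewrite op_mul_conj mulr_suml mulr_sumr; apply: eq_bigr => l _.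
by rewrite expr2 -mulrA comp_op_clifford mulrA comp_op_clifford mulrA.
Qed.

(** The pencil is written with s on the left of the trace 2 T_0, so on this side
    the factorization comes from T commuting with its conjugate; in [pencil_left]
    it comes from the trace commuting with s. *)
Lemma pencil_right s T :
  pencil s T = cop (pcliff s) * (cop (pcliff s) - conj_op T)
               - (cop (pcliff s) - conj_op T) * bc_op T.
Proof.
rewrite /pencil /opL mulr1 expr2 op_of_cliffordM.
move: (bc_op T) (conj_op T) (conj_op_mul T) => x z zx.
rewrite mulrDr mulrBr mulrBl zx opprB [_ * x + _]addrC opprD !addrA.
by rewrite [LHS]addrAC.
Qed.

Lemma pencil_left s T :
  pencil s T = (cop (pcliff s) - conj_op T) * cop (pcliff s)
               - bc_op T * (cop (pcliff s) - conj_op T).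
Proof.
rewrite /pencil /opL mulr1 expr2 op_of_cliffordM -trace_clifford.
move: (bc_op T) (conj_op T) => x z.
rewrite mulrDl mulrBl mulrBr opprB [x * _ + _]addrC opprD !addrA.
by rewrite [LHS]addrAC.
Qed.

Lemma QinvP {s T} : rhoF T s -> is_inverse (pencil s T) (Qinv s T).
Proof. by move=> [S PS]; apply: (@xgetI _ _ [set S | is_inverse _ S] S). Qed.

Lemma Qinv_comm {s T} : rhoF T s ->
  cop (pcliff s) * Qinv s T = Qinv s T * cop (pcliff s).
Proof.
move=> /QinvP[PQ QP].
have cP : cop (pcliff s) * pencil s T = pencil s T * cop (pcliff s).
  rewrite /pencil /opL mulr1 expr2 op_of_cliffordM.
  move: (_ + conj_op T) (_ * conj_op T) (trace_clifford T (pcliff s))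
    (norm_clifford T (pcliff s)) => t m ct cm.
  by rewrite mulrDr mulrBr mulrDl mulrBl cm -!mulrA ct.
rewrite -[LHS]mul1r -QP -!mulrA; congr (_ * _).
by rewrite mulrA -cP -mulrA PQ mulr1.
Qed.

End Operators.

(** * The resolvent equation *)

Theorem lemma4p1 (R : realType) (V : completeNormedModType R) (T : BC01 V 5)
    (p s : paravector R 5) (hp : rhoF T p) (hs : rhoF T s)
    (hsp : ~ psphere p s) :
  F5R s T * SLinv p T + SRinv s T * F5L p T
    + gamma5 R *: (Qinv s T * SRinv s T * SLinv p T * Qinv p T)
    + gamma5 R *: (Qinv s T ^+ 2 * Qinv p T + Qinv s T * Qinv p T ^+ 2)
  = ((F5R s T - F5L p T) *:r pcliff p
       - pcliff (pconj s) *:l (F5R s T - F5L p T))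
    *:r (pcliff p ^+ 2 - (2 * pre s) *: pcliff p + (pabs s ^+ 2)%:A)^-1.
Proof.
rewrite /F5R /F5L /SLinv /SRinv /opL /opR !mulr1.
have [_ Qs] := QinvP hs; have [Pp _] := QinvP hp.
rewrite pencil_right in Qs; rewrite pencil_left in Pp.
have dy := resolvent_sum_commutator (Qinv_comm hs) (Qinv_comm hp) Qs Pp.
(* dy is the commutator identity for the left-hand side divided by gamma_5. *)
move: dy (sphere_polynomial_unit hsp); set D := _ + _%:A => /=.
set q := Qinv s T; set r := Qinv p T; set cs := rlop_of_clifford V (pcliff s).
set cp := rlop_of_clifford V (pcliff p).
set c := rlop_of_clifford V (pcliff (pconj s)).
set z := conj_op T; set y := _ + (_ + _) => dy Du.
have copD : rlop_of_clifford V D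
    = cp ^+ 2 - (2 * pre s) *: cp + pabs s ^+ 2 *: (1 : rlop V 5).
  rewrite /D -scaleNr !op_of_cliffordD !op_of_cliffordZ op_of_cliffordM.
  by rewrite rlop_of_clifford1 scaleNr.
have yD : y * rlop_of_clifford V D
    = (q ^+ 3 * (cs - z) - (cp - z) * r ^+ 3) * cp
      - c * (q ^+ 3 * (cs - z) - (cp - z) * r ^+ 3).
  have csDc : cs + c = (2 * pre s) *: (1 : rlop V 5).
    by rewrite -op_of_cliffordD pcliffD_pconj op_of_clifford_alg.
  have ccs : c * cs = pabs s ^+ 2 *: (1 : rlop V 5).
    by rewrite -op_of_cliffordM mul_pconj_pcliff op_of_clifford_alg.
  rewrite -[q ^+ 3 * _ - _]opprB -dy mulNr mulrN opprK addrC.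
  rewrite -quadratic_commutator csDc ccs -!rlop_scaleAl !mul1r copD.
  by rewrite mulrDr mulrBr -!rlop_scaleAr mulr1.
have yE : y = ((q ^+ 3 * (cs - z) - (cp - z) * r ^+ 3) * cp
      - c * (q ^+ 3 * (cs - z) - (cp - z) * r ^+ 3)) * rlop_of_clifford V D^-1.
  by rewrite -yD -mulrA -op_of_cliffordM divrr // rlop_of_clifford1 mulr1.
move: yE; rewrite /y; move: (cs - z) (cp - z) => u v yE.
rewrite -scalerBr -!(rlop_scaleAl (gamma5 R)) -!(rlop_scaleAr (gamma5 R)).
rewrite -scalerBr -(rlop_scaleAl (gamma5 R)) -yE -!scalerDr.
by congr (_ *: (_ + _ + _)); rewrite expr2 -!mulrA.
Qed.
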